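(* Let $\mu$ be a non-negative measure on $\Omega$ with finite moments, let $\mathfrak{a}:=\mathrm{I}(\operatorname{supp}\mu)\subseteq L$ be the vanishing ideal of its support and let $\sigma\colon L\to\mathbb{K}$ be its moment functional. Let $W\subseteq L$ be a $\mathbb{K}$-vector subspace. Then $\langle\cdot,\cdot\rangle_\sigma$ induces a positive-definite form on $W/(\mathfrak{a}\cap W)$. In particular, if $W$ is finite-dimensional and $B$ is a basis of $W$, let $H:=\bigl(\langle w,v\rangle_\sigma\bigr)_{w,v\in B}$. Then $$\mathfrak{a}\cap W=\ker H.$$ Furthermore, $H$ is non-singular if and only if the elements of $B$ are linearly independent modulo $\mathfrak{a}\cap W$.
   Context: The statement concerns each of the following two settings ($n\in\mathbb{N}$). Affine case: $\Omega=\mathbb{R}^n$, $\mathbb{K}=\mathbb{R}$, $L=\mathbb{R}[x_1,\dots,x_n]$, and the involution $\circ$ on $\mathbb{K}$ and $L$ is the identity. Trigonometric case: $\Omega=\mathbb{T}^n=\{z\in\mathbb{C}^n:|z_1|=\dots=|z_n|=1\}$, $\mathbb{K}=\mathbb{C}$, $L=\mathbb{C}[x_1^{\pm1},\dots,x_n^{\pm1}]$, and the involution on $L$ is $\bigl(\sum_\alpha p_\alpha x^\alpha\bigr)^{\circ}=\sum_\alpha\overline{p_\alpha}\,x^{-\alpha}$. Non-negative measures are Borel measures. The support $\operatorname{supp}\mu$ is the set of $\xi\in\Omega$ such that $\mu|_U\ne0$ for every open neighborhood $U\subseteq\Omega$ of $\xi$. For $X\subseteq\Omega$, $\mathrm{I}(X)=\{p\in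 L:p(\xi)=0\ \forall\xi\in X\}$. The moment functional is $\sigma(p)=\int_\Omega p\,\mathrm{d}\mu$ for $p\in L$, and $\langle q,p\rangle_\sigma:=\sigma(q^{\circ}p)$ for $q,p\in L$ (semilinear in the first, linear in the second argument). The induced form is $(q+\mathfrak{a}\cap W,\;p+\mathfrak{a}\cap W)\mapsto\langle q,p\rangle_\sigma$ for $q,p\in W$. The kernel of the matrix $H$ is regarded as a subspace of $W$ via the basis $B$. *)

(* Defs.v *)
From HB Require Import structures.
From mathcomp Require Import all_boot all_order all_algebra.
From mathcomp Require Import generic_quotient ring_quotient sesquilinear.
From mathcomp Require Import finmap complex.
From mathcomp Require Import boolp classical_sets reals ereal topology.
From mathcomp Require Import normedtype measure lebesgue_integral.
(* The notations of multinomials are incompatible with those of analysis. *)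
From mathcomp Require Import -(notations) mpoly.
From mathcomp Require Import -(notations) monalg.

Set Implicit Arguments.
Unset Strict Implicit.
Unset Printing Implicit Defensive.

Import Order.TTheory GRing.Theory Num.Theory.
Import numFieldNormedType.Exports.

Local Open Scope classical_set_scope.
Local Open Scope ring_scope.

(* F[x_1^{+-1}, ..., x_n^{+-1}] is the group algebra of Z^n: finitely supported
   functions on Z^n under convolution.  The ring structure that monalg puts on
   [malg] is not available, because it requires a monoid of exponents without
   nontrivial units. *)
Definition laurent (n : nat) (F : comNzRingType) : Type :=
  malg 'rV[int]_n F.

Fact malg_scaleU (I : choiceType) (F : nzRingType) (k : I) (c d : F) :
  c *: mkmalgU k d = mkmalgU k (c * d).
Proof. by apply/malgP => l; rewrite mcoeffZ !mcoeffU mulrnAr. Qed.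

Section LaurentRing.
Variables (n : nat) (F : comNzRingType).
Local Notation L := (laurent n F).
Implicit Types (p q : L) (a : 'rV[int]_n) (c : F).

HB.instance Definition _ := GRing.Lmodule.copy L (malg 'rV[int]_n F).

Definition lmonom a c : L := mkmalgU a c.

Definition lmul p q : L :=
  \sum_(a <- msupp p) \sum_(b <- msupp q)
    lmonom (a + b) (monalg.mcoeff a p * monalg.mcoeff b q).

Lemma lmonom0 a : lmonom a 0 = 0. Proof. exact: monalgU0. Qed.

Lemma lmonomD a c d : lmonom a (c + d) = lmonom a c + lmonom a d.
Proof. exact: monalgUD. Qed.

Lemma lmulw (A B : {fset 'rV[int]_n}) p q :
  (msupp p `<=` A)%fset -> (msupp q `<=` B)%fset ->
  lmul p q = \sum_(a <- A) \sum_(b <- B)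
    lmonom (a + b) (monalg.mcoeff a p * monalg.mcoeff b q).
Proof.
move=> pA qB; rewrite /lmul (big_fset_incl _ pA) /=.
  apply/eq_bigr => a _; apply/big_fset_incl => // b _ /mcoeff_outdom ->.
  by rewrite mulr0 lmonom0.
move=> a _ /mcoeff_outdom pa.
by rewrite big1 // => b _; rewrite pa mul0r lmonom0.
Qed.

Lemma lmulC : commutative lmul.
Proof.
move=> p q; rewrite /lmul exchange_big /=; apply/eq_bigr => b _.
by apply/eq_bigr => a _; rewrite addrC mulrC.
Qed.

Lemma lmulDl : left_distributive lmul +%R.
Proof.
move=> p q r.
rewrite (lmulw (msuppD_le p q) (fsubset_refl _)).
rewrite (lmulw (fsubsetUl _ (msupp q)) (fsubset_refl (msupp r))).
rewrite (lmulw (fsubsetUr (msupp p) _) (fsubset_refl (msupp r))).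
rewrite -big_split /=; apply/eq_bigr => a _.
rewrite -big_split /=; apply/eq_bigr => b _.
by rewrite mcoeffD mulrDl lmonomD.
Qed.

Lemma lmul0p : left_zero 0 lmul.
Proof. by move=> p; rewrite /lmul msupp0 big_seq_fset0. Qed.

Lemma lmulDr : right_distributive lmul +%R.
Proof. by move=> p q r; rewrite lmulC lmulDl !(lmulC p). Qed.

Lemma lmulp0 : right_zero 0 lmul.
Proof. by move=> p; rewrite lmulC lmul0p. Qed.

Lemma lmulUU a b c d :
  lmul (lmonom a c) (lmonom b d) = lmonom (a + b) (c * d).
Proof. by rewrite (lmulw msuppU_le msuppU_le) !big_seq_fset1 !mcoeffUU. Qed.

Lemma laurentE p :
  p = \sum_(a <- msupp p) lmonom a (monalg.mcoeff a p).
Proof. exact: monalgE. Qed.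

Lemma lmul_suml (I : Type) (s : seq I) (E : I -> L) q :
  lmul (\sum_(i <- s) E i) q = \sum_(i <- s) lmul (E i) q.
Proof. exact: (big_morph (lmul^~ q) (fun x y => lmulDl x y q) (lmul0p q)). Qed.

Lemma lmul_sumr (I : Type) (s : seq I) (E : I -> L) q :
  lmul q (\sum_(i <- s) E i) = \sum_(i <- s) lmul q (E i).
Proof. exact: (big_morph (lmul q) (lmulDr q) (lmulp0 q)). Qed.

Lemma lmulA : associative lmul.
Proof.
move: laurentE lmul_suml lmul_sumr lmulUU.
move: lmul lmonom => op mon monE op_suml op_sumr opU p q r.
rewrite [p]monE [q]monE [r]monE.
rewrite !op_suml; apply/eq_bigr => a _.
rewrite 2![op (mon _ _) (\sum_(i <- msupp q) _)]op_sumr op_suml.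
apply/eq_bigr => b _; rewrite !op_sumr; apply/eq_bigr => e _.
by rewrite !opU addrA mulrA.
Qed.

Lemma lmul1p : left_id (lmonom 0 1) lmul.
Proof.
move=> p; rewrite [p]laurentE lmul_sumr; apply/eq_bigr => a _.
by rewrite lmulUU add0r mul1r.
Qed.

Lemma lone_neq0 : lmonom 0 1 != 0.
Proof.
apply/eqP => /(congr1 (monalg.mcoeff 0)) /eqP.
by rewrite mcoeffUU mcoeff0 oner_eq0.
Qed.

HB.instance Definition _ := GRing.Zmodule_isComNzRing.Build L
  lmulA lmulC lmul1p lmulDl lone_neq0.

Lemma lscaleU c a d : c *: lmonom a d = lmonom a (c * d).
Proof. exact: malg_scaleU. Qed.

Lemma lscaleAl c p q : c *: (p * q) = (c *: p) * q.
Proof.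
have -> : (c *: p) * q = \sum_(a <- msupp p) \sum_(b <- msupp q)
    lmonom (a + b) (monalg.mcoeff a (c *: p) * monalg.mcoeff b q).
  exact: (lmulw (msuppZ_le c p) (fsubset_refl _)).
rewrite [LHS]scaler_sumr; apply/eq_bigr => a _.
rewrite scaler_sumr; apply/eq_bigr => b _.
by rewrite lscaleU mcoeffZ mulrA.
Qed.

HB.instance Definition _ := GRing.Lmodule_isLalgebra.Build F L lscaleAl.
HB.instance Definition _ := GRing.Lalgebra_isComAlgebra.Build F L.
End LaurentRing.

(* [x ^ k] for [k : int] is a meaningful negative power only for [x != 0]. *)
Definition leval (n : nat) (F : fieldType) (z : 'rV[F]_n) (p : laurent n F) : F :=
  \sum_(a <- msupp p) monalg.mcoeff a p * \prod_(i < n) z 0 i ^ a 0 i.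

Section LaurentEval.
Variables (n : nat) (F : fieldType) (z : 'rV[F]_n).

Fact leval_is_linear : linear_for *%R (@leval n F z).
Proof.
have Eadd p q : leval z (p + q) = leval z p + leval z q.
  exact: (raddfD (mmap idfun (fun a : 'rV[int]_n => \prod_(i < n) z 0 i ^ a 0 i))).
move=> c p q; rewrite Eadd; congr (_ + _); rewrite /leval.
rewrite (big_fset_incl _ (msuppZ_le c p)) /=; last first.
  by move=> a _ /mcoeff_outdom ->; rewrite mul0r.
by rewrite mulr_sumr; apply/eq_bigr => a _; rewrite mcoeffZ mulrA.
Qed.

HB.instance Definition _ :=
  GRing.isLinear.Build F (laurent n F) F *%R (@leval n F z) leval_is_linear.
End LaurentEval.

Definition linvol (n : nat) (R : rcfType) (p : laurent n R[i]) :
    laurent n R[i] :=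
  \sum_(a <- msupp p) lmonom (- a) (conjc (monalg.mcoeff a p)).

(* [R[i]^o] rather than [R[i]], because the former carries the topology. *)
Definition torus_set (R : realType) (n : nat) : set 'rV[R[i]^o]_n :=
  [set z | forall i, `|z 0 i| = 1].

Arguments torus_set : clear implicits.

Definition torus (R : realType) (n : nat) : Type := set_type (torus_set R n).

Section Torus.
Variables (R : realType) (n : nat).

Fact torus1 : (const_mx 1 : 'rV[R[i]^o]_n) \in torus_set R n.
Proof. by apply/mem_set => i; rewrite mxE normr1. Qed.

HB.instance Definition _ :=
  Topological.copy (torus R n) (set_type (torus_set R n)).
HB.instance Definition _ := isPointed.Build (torus R n) (SigSub torus1).
End Torus.

(* The data common to the affine and the trigonometric case.  The maps [re],
   [im] and [mk] give the real coordinates of scalars, through which integrals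
   are computed. *)
Record setting (R : realType) := Setting {
  base_field : numFieldType;
  conjK : {rmorphism base_field -> base_field};
  re : base_field -> R;
  im : base_field -> R;
  mk : R -> R -> base_field;
  lpoly : comAlgType base_field;
  monomials : set lpoly;
  invol : lpoly -> lpoly;
  Omega : ptopologicalType;
  ev : Omega -> {scalar lpoly}
}.

Arguments conjK {R} s.
Arguments mk {R} s _ _.
Arguments monomials {R} s.

Definition affine (R : realType) (n : nat) : setting R := {|
  base_field := R;
  conjK := idfun;
  re := idfun;
  im := fun=> 0;
  mk := fun a _ => a;
  lpoly := mpoly n R;
  monomials := range (@mpolyX n R);
  invol := idfun;
  Omega := 'rV[R]_n;
  ev := fun x => @meval n R (fun i => x 0 i)
|}.

Definition trigonometric (R : realType) (n : nat) : setting R := {|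
  base_field := R[i];
  conjK := @conjc R;
  re := @complex.Re R;
  im := @complex.Im R;
  mk := @Complex R;
  lpoly := laurent n R[i];
  monomials := range (fun a => @lmonom n R[i] a 1);
  invol := @linvol n R;
  Omega := torus R n;
  ev := fun z => @leval n R[i] (val z)
|}.

Notation borel T := (g_sigma_algebraType (@open T)).

Section Moments.
Variables (R : realType) (S : setting R).
Local Notation K := (base_field S).
Local Notation L := (lpoly S).
Variable mu : {measure set (borel (Omega S)) -> \bar R}.

Definition integrableK (f : Omega S -> K) : Prop :=
  mu.-integrable setT (fun x => (re (f x))%:E) /\
  mu.-integrable setT (fun x => (im (f x))%:E).

Definition integralK (f : Omega S -> K) : K :=
  mk S (\int[mu]_x re (f x)) (\int[mu]_x im (f x)).

Definition finite_moments : Prop :=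
  forall m, monomials S m -> integrableK (fun x => ev x m).

Definition supp : set (Omega S) :=
  [set x | forall U : set (borel (Omega S)), open (U : set (Omega S)) -> U x ->
    exists2 A : set (borel (Omega S)), measurable A & mu (A `&` U) != 0%E].

Definition moment (p : L) : K := integralK (fun x => ev x p).

(* Semilinear in [q] and linear in [p]. *)
Definition mform (q p : L) : K := moment (invol q * p).
End Moments.

Section VanishingIdeal.
Variables (R : realType) (S : setting R) (X : set (Omega S)).

Definition vanishing : {pred lpoly S} :=
  fun p => `[< forall x, X x -> ev x p = 0 >].

Fact vanishing_submod_closed : GRing.submod_closed vanishing.
Proof.
split=> [|a p q /asboolP p0 /asboolP q0]; apply/asboolP => x Xx.
  exact: raddf0.
by rewrite linearP /= p0 // q0 // mulr0 addr0.
Qed.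

HB.instance Definition _ :=
  GRing.isSubmodClosed.Build (base_field S) (lpoly S) vanishing
    (GRing.submod_closed_semi vanishing_submod_closed).
End VanishingIdeal.

Section Subspace.
Variables (K : fieldType) (V : lmodType K) (W : submodClosed V).

Record subspace_of := Subspace_of { sval_of : V; _ : sval_of \in W }.

HB.instance Definition _ := [isSub for sval_of].
HB.instance Definition _ := [Choice of subspace_of by <:].
HB.instance Definition _ := [SubChoice_isSubLmodule of subspace_of by <:].
End Subspace.

(* [N :&: W], as a subspace of [W]. *)
Section Trace.
Variables (K : fieldType) (V : lmodType K) (N W : submodClosed V).

Definition trace_in : {pred subspace_of W} := fun w => val w \in N.

Fact trace_in_submod_closed : GRing.submod_closed trace_in.
Proof.
split=> [|a u v uN vN]; rewrite unfold_in /= ?rpred0 //.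
by rewrite rpredD ?rpredZ.
Qed.

HB.instance Definition _ :=
  GRing.isSubmodClosed.Build K (subspace_of W) trace_in
    (GRing.submod_closed_semi trace_in_submod_closed).
End Trace.

Arguments trace_in {K V} N W _.

Section QuotientSpace.
Variables (K : fieldType) (V : lmodType K) (N : submodClosed V).

(* A [submodClosed] is not canonically a [zmodClosed]. *)
Definition zmod_pred : {pred V} := fun v => v \in N.

HB.instance Definition _ := GRing.isZmodClosed.Build V zmod_pred
  (GRing.submod_closedB (submodClosedP N)).

Definition quotient : Type := @Quotient.quot V zmod_pred.

HB.instance Definition _ := GRing.Zmodule.on quotient.

Definition proj (v : V) : quotient := (\pi_(@Quotient.quot V zmod_pred) v)%qT.

Definition qscale (a : K) (x : quotient) : quotient :=
  proj (a *: (repr (x : @Quotient.quot V zmod_pred))).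

Lemma proj_eq u v : (proj u = proj v) <-> (u - v \in N).
Proof.
rewrite -[u - v \in N]/(u - v \in (zmod_pred : zmodClosed V)).
by rewrite Quotient.idealrBE; split=> /eqP.
Qed.

Lemma proj_surj (x : quotient) : {v | x = proj v}.
Proof. by exists (repr (x : @Quotient.quot V zmod_pred)); rewrite /proj reprK. Qed.

Lemma projD u v : proj (u + v) = proj u + proj v.
Proof. exact: raddfD. Qed.

Lemma qscaleE a v : qscale a (proj v) = proj (a *: v).
Proof.
apply/proj_eq; rewrite -scalerBr rpredZ //; apply/proj_eq.
by rewrite {1}/proj reprK.
Qed.

Fact qscaleA a b x : qscale a (qscale b x) = qscale (a * b) x.
Proof. by have [v ->] := proj_surj x; rewrite !qscaleE scalerA. Qed.

Fact qscale1 : left_id 1 qscale.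
Proof. by move=> x; have [v ->] := proj_surj x; rewrite qscaleE scale1r. Qed.

Fact qscaleDr : right_distributive qscale +%R.
Proof.
move=> a x y; have [u ->] := proj_surj x; have [v ->] := proj_surj y.
by rewrite -projD !qscaleE scalerDr projD.
Qed.

Fact qscaleDl x : {morph qscale^~ x : a b / a + b}.
Proof.
by move=> a b; have [v ->] := proj_surj x; rewrite !qscaleE scalerDl projD.
Qed.

HB.instance Definition _ := GRing.Zmodule_isLmodule.Build K quotient
  qscaleA qscale1 qscaleDr qscaleDl.

Fact proj_is_linear : linear proj.
Proof. by move=> a u v; rewrite projD -qscaleE. Qed.

HB.instance Definition _ :=
  GRing.isLinear.Build K V quotient *:%R proj proj_is_linear.
End QuotientSpace.

Section Bases.
Variables (K : fieldType) (V : lmodType K) (d : nat) (B : 'I_d -> V).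

Definition lin_indep : Prop :=
  forall c : 'I_d -> K, \sum_i c i *: B i = 0 -> forall i, c i = 0.

Definition is_basis : Prop :=
  lin_indep /\ forall v, exists c : 'I_d -> K, v = \sum_i c i *: B i.
End Bases.

Definition gram (R : realType) (S : setting R)
    (mu : {measure set (borel (Omega S)) -> \bar R})
    (W : submodClosed (lpoly S)) (d : nat) (B : 'I_d -> subspace_of W) :
    'M[base_field S]_d :=
  \matrix_(i, j) mform mu (val (B i)) (val (B j)).

(* Main.v *)
Require Import Defs.
From HB Require Import structures.
From mathcomp Require Import all_boot all_order all_algebra.
From mathcomp Require Import generic_quotient sesquilinear complex finmap.
From mathcomp Require Import boolp classical_sets functions cardinality.
From mathcomp Require Import reals ereal topology.
From mathcomp Require Import normedtype measure lebesgue_integral.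
From mathcomp Require Import -(notations) mpoly.
From mathcomp Require Import -(notations) monalg.

(** The integrand of [mform mu q p] at [x] is the product of the conjugate of
    [ev x q] with [ev x p], because evaluation is multiplicative and turns the
    involution into conjugation (on the torus, since the conjugate of a number
    of modulus 1 is its inverse).  Hence the form is Hermitian, and
    [mform mu p p] is the integral of the squared modulus of [p].

    That integral vanishes iff [p] vanishes almost everywhere, and the point is
    that this is the same as vanishing on the support of [mu].  The set
    [p != 0] is open because [p] is continuous.  If it is null, then by the
    definition of the support it contains no point of the support
    ([null_nonzero]).  Conversely, if [p] vanishes on the support, each point
    of the open set [p != 0] has a null open neighborhood; as the topology has a
    countable base, countably many of these cover the set, which is therefore
    null ([null_open], [nonzero_null]).  So the form is strictly positive off
    the ideal ([mform_pos]), while each element of the ideal is orthogonal to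
    everything ([mform_null]).

    The rest is linear algebra over any Hermitian form that is positive off a
    subspace [N] and zero on [N].  It descends to a positive-definite form on
    the quotient by [N] ([quotient_dot]).  For a family [B] with Gram matrix
    [H], the vector [H *m c] lists the products of the [B i] with
    [v := \sum_i c i 0 *: B i]; if it is zero then [v] is orthogonal to itself,
    so [v \in N] ([gram_kerE]), and invertibility of [H] is the absence of
    nontrivial relations between the [B i] modulo [N] ([gram_unitE]).

    The two cases of the theorem enter only through the properties collected in
    [moment_axioms]. *)

Set Implicit Arguments.
Unset Strict Implicit.
Unset Printing Implicit Defensive.

Import Order.TTheory GRing.Theory Num.Theory.
Import numFieldNormedType.Exports.

Local Open Scope classical_set_scope.
Local Open Scope ring_scope.

(** * Second countable spaces *)

Lemma second_countable_family (T : topologicalType) (I : countType)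
    (b : I -> set T) :
  (forall i, open (b i)) ->
  (forall x V, nbhs x V -> exists2 i, b i x & b i `<=` V) ->
  @second_countable T.
Proof.
move=> ob nb; exists (range b).
  exact: sub_countable (card_image_le _ _) (countableP _).
split=> [_ [i _ <-] //|x V /nb [i bix biV]].
by exists (b i) => //; split=> //; exists i.
Qed.

Lemma second_countable_seq (T : topologicalType) : @second_countable T ->
  exists b : nat -> set T, (forall k, open (b k)) /\
    forall x V, nbhs x V -> exists2 k, b k x & b k `<=` V.
Proof.
move=> [B /countable_injP [f finj] [oB nB]].
(* The union has at most one member, since [f] is injective on [B]; taking a
   union provides the empty set at indices outside the image of [f]. *)
exists (fun k => \bigcup_(U in [set U | B U /\ f U = k]) U); split=> [k|x V].
  by apply: bigcup_open => U [/oB].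
move=> /nB [U [BU Ux] UV]; exists (f U) => [|y [W [BW WU] Wy]].
  by exists U.
by apply: UV; rewrite /= -(finj W U) ?inE.
Qed.

(** The balls of [R[i]^o] have radii in [R[i]], which is not a [realType]; an
    Archimedean condition on [K] covers this case as well as [R]. *)
Lemma second_countable_dense (K : numFieldType) (T : pseudoMetricType K)
    (I : countType) (D : I -> T) :
  (forall e : K, 0 < e -> exists k, k.+1%:R^-1 < e) ->
  (forall (x : T) (e : K), 0 < e -> exists i, ball x e (D i)) ->
  @second_countable T.
Proof.
move=> archK denseD.
apply: (@second_countable_family _ (I * nat)%type
  (fun ik => (ball (D ik.1) (ik.2.+1%:R^-1 : K))°)) => [ik|x V].
  exact: open_interior.
move=> /nbhs_ballP [e /= e0 eV].
(* A radius below [e / 2] keeps the ball around [D i] inside [V]; choosing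
   [D i] within half of that radius puts [x] in its interior. *)
have [k ke] := archK _ (divr_gt0 e0 (ltr0Sn _ 1)).
have k0 : 0 < k.+1%:R^-1 :> K by rewrite invr_gt0 ltr0Sn.
have [i xi] := denseD x _ (divr_gt0 k0 (ltr0Sn _ 1)).
exists (i, k) => [|y /interior_subset /= iy] /=.
  apply: (@interiorS _ (ball x (k.+1%:R^-1 / 2)%R)) => [y xy|].
    by rewrite [k.+1%:R^-1]splitr; apply: ball_triangle xy; exact: ball_sym.
  by apply: nbhsx_ballx; rewrite divr_gt0.
apply: eV; rewrite [e]splitr; apply: (@ball_triangle _ _ (D i)).
  apply: le_ball xi; apply: le_trans (ltW ke).
  by rewrite ler_pdivrMr ?ltr0Sn // ler_peMr ?(ltW k0) // ler1n.
exact: le_ball (ltW ke) _ iy.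
Qed.

Lemma second_countable_mx (T : topologicalType) (m n : nat) :
  @second_countable T -> @second_countable 'M[T]_(m, n).
Proof.
move=> /second_countable_seq [b [ob nb]].
apply: (@second_countable_family _ 'M[nat]_(m, n)
  (fun k => [set A : 'M[T]_(m, n) | forall i j, b (k i j) (A i j)])) => [k|A V].
  rewrite openE => A kA; exists (fun i j => b (k i j)) => // i j.
  by apply: open_nbhs_nbhs; split.
move=> [P AP PV].
have /choice [k Hk] : forall ij : 'I_m * 'I_n, exists l,
    b l (A ij.1 ij.2) /\ b l `<=` P ij.1 ij.2.
  by move=> ij; have [l] := nb _ _ (AP ij.1 ij.2); exists l.
exists (\matrix_(i, j) k (i, j)) => [i j|C kC].
  by rewrite mxE; have [] := Hk (i, j).
by apply: PV => i j; have [_] := Hk (i, j); apply; have := kC i j; rewrite mxE.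
Qed.

Lemma second_countable_initial (S : choiceType) (T : topologicalType)
    (f : S -> T) :
  @second_countable T -> @second_countable (initial_topology f).
Proof.
move=> /second_countable_seq [b [ob nb]].
apply: (@second_countable_family (initial_topology f) nat
  (fun k => f @^-1` b k)) => [k|x V].
  by exists (b k).
rewrite nbhsE => -[_ [[U oU <-] Ux] UV].
have [|k bx bU] := nb (f x) U; first exact: open_nbhs_nbhs.
by exists k => // y /bU /UV.
Qed.

Lemma archi_inv (R : realType) (e : R) : 0 < e -> exists k, k.+1%:R^-1 < e.
Proof.
move=> e0; have [k ke] := @ltr_add_invr R 0 e e0.
by exists k; rewrite add0r in ke.
Qed.

Lemma rat_approx (R : realType) (x e : R) : 0 < e ->
  exists q : rat, `|x - ratr q| < e.
Proof.
move=> e0.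
have [|z [xz [q _ qz]]] := @dense_rat R (ball x e) _ (@ball_open _ _ x e).
  by exists x; exact: ballxx.
by exists q; rewrite qz; move: xz; rewrite -ball_normE.
Qed.

Lemma second_countable_real (R : realType) : @second_countable R.
Proof.
apply: (@second_countable_dense _ R rat ratr) => [e|x e e0].
  exact: archi_inv.
by have [q xq] := rat_approx x e0; exists q; rewrite -ball_normE.
Qed.

Lemma second_countable_complex (R : realType) : @second_countable (R[i]^o).
Proof.
apply: (@second_countable_dense _ (R[i]^o) (rat * rat)%type
   (fun q => Complex (ratr q.1) (ratr q.2))) => [[e e']|[x y] [e e']].
  (* A positive element of [R[i]] is real, by the definition of the order. *)
  rewrite ltcE /= => /andP[/eqP -> /archi_inv [k ke]]; exists k.
  have -> : (k.+1%:R^-1 : R[i]) = (k.+1%:R^-1)%:C%C.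
    by rewrite rmorphV ?unitfE // rmorph_nat.
  by rewrite ltcR.
rewrite ltcE /= => /andP[/eqP -> e0].
have [q xq] := rat_approx x (divr_gt0 e0 (ltr0Sn _ 1)).
have [r yr] := rat_approx y (divr_gt0 e0 (ltr0Sn _ 1)).
exists (q, r); rewrite -ball_normE /= normc_def /= ltcR.
set a := x - _ in xq *; set b := y - _ in yr *.
rewrite -[e](gtr0_norm e0) -sqrtr_sqr ltr_sqrt ?exprn_gt0 //.
rewrite -(real_normK (num_real a)) -(real_normK (num_real b)).
apply: (@lt_le_trans _ _ ((e / 2) ^+ 2 + (e / 2) ^+ 2)).
  by apply: ltrD; rewrite ltr_pXn2r ?nnegrE ?normr_ge0 ?divr_ge0 ?(ltW e0).
rewrite [X in _ <= X ^+ 2]splitr sqrrD -addrA lerD2l lerDr.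
by rewrite mulrn_wge0 // mulr_ge0 // divr_ge0 ?(ltW e0).
Qed.

(** Being null can be checked locally on an open set: the null members of a
    countable base cover it, since every null neighborhood contains one around
    its point. *)
Lemma null_open (R : realType) (T : ptopologicalType)
    (mu : {measure set (borel T) -> \bar R}) (U : set (borel T)) :
  @second_countable T -> open (U : set T) ->
  (forall x, U x -> exists V : set (borel T),
    [/\ open (V : set T), V x & mu V = 0%E]) ->
  mu U = 0%E.
Proof.
move=> /second_countable_seq [b [ob nb]] oU nullU.
have mo (V : set (borel T)) : open (V : set T) -> measurable V.
  by move=> oV; exact: sub_sigma_algebra.
apply/negligibleP; first exact: mo.
pose F k : set (borel T) := if mu (b k) == 0%E then b k else set0.
apply: (@negligibleS _ _ _ _ (\bigcup_k F k)) => [x Ux|].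
  have [V [oV Vx V0]] := nullU x Ux.
  have [|k bx bV] := nb x V; first exact: open_nbhs_nbhs.
  exists k => //; rewrite /F; case: eqP => // -[].
  by apply: (@subset_measure0 _ _ _ mu _ V) => //; exact: mo.
apply: negligible_bigcup => k; rewrite /F; case: eqP => [b0|_].
  by apply/negligibleP => //; exact: mo.
exact: negligible_set0.
Qed.

(** * The moment form of a measure *)

(** What the affine and the trigonometric case have in common.  The scalar
    [mk S a b] stands for [a + b * i], where [i = 0] and [im = 0] in the affine
    case; there [im (mk S a b) = b] fails, which is why [mkM] multiplies by a
    scalar given through its coordinates rather than by some [mk S a' b']. *)
Record moment_axioms (R : realType) (S : setting R) : Prop := {
  reD : forall x y : base_field S, re (x + y) = re x + re y;
  imD : forall x y : base_field S, im (x + y) = im x + im y;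
  reM : forall x y : base_field S, re (x * y) = re x * re y - im x * im y;
  imM : forall x y : base_field S, im (x * y) = re x * im y + im x * re y;
  re_im_eq0 : forall x : base_field S, re x = 0 -> im x = 0 -> x = 0;
  mkD : forall a b a' b', mk S (a + a') (b + b') = mk S a b + mk S a' b';
  mkM : forall c a b,
    mk S (re c * a - im c * b) (re c * b + im c * a) = c * mk S a b;
  re_conj : forall x, re (conjK S x) = re x;
  im_conj : forall x, im (conjK S x) = - im x;
  conj_mk : forall a b, conjK S (mk S a b) = mk S a (- b);
  mk_gt0 : forall a, 0 < a -> 0 < mk S a 0;
  evM : forall (x : Omega S) p q, ev x (p * q) = ev x p * ev x q;
  ev_invol : forall (x : Omega S) p, ev x (invol p) = conjK S (ev x p);
  monomials_ind : forall P : lpoly S -> Prop, P 0 ->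
    (forall c m p, monomials S m -> P p -> P (c *: m + p)) -> forall p, P p;
  open_nonzero : forall p : lpoly S, open [set x : Omega S | ev x p != 0];
  Omega_second_countable : @second_countable (Omega S)
}.

Section Moments.
Variables (R : realType) (S : setting R) (axS : moment_axioms S).
Variable mu : {measure set (borel (Omega S)) -> \bar R}.
Local Notation K := (base_field S).
Local Notation L := (lpoly S).

Lemma re0 : re (0 : K) = 0.
Proof. by apply: (addrI (re (0 : K))); rewrite -(reD axS) !addr0. Qed.

Lemma im0 : im (0 : K) = 0.
Proof. by apply: (addrI (im (0 : K))); rewrite -(imD axS) !addr0. Qed.

Lemma mk0 : mk S 0 0 = 0.
Proof. by apply: (addrI (mk S 0 0)); rewrite -(mkD axS) !addr0. Qed.

Lemma Rintegral_lin (f g : borel (Omega S) -> R) (a b : R) :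
  mu.-integrable setT (EFin \o f) -> mu.-integrable setT (EFin \o g) ->
  mu.-integrable setT (fun x => (a * f x + b * g x)%:E) /\
  \int[mu]_x (a * f x + b * g x) = a * \int[mu]_x f x + b * \int[mu]_x g x.
Proof.
move=> fi gi.
have afi : mu.-integrable setT (EFin \o (fun x => a * f x)).
  exact: (integrableZl measurableT a fi).
have bgi : mu.-integrable setT (EFin \o (fun x => b * g x)).
  exact: (integrableZl measurableT b gi).
split; first exact: (integrableD measurableT afi bgi).
by rewrite (RintegralD measurableT afi bgi) !RintegralZl.
Qed.

Lemma integralK_lin c (f g : Omega S -> K) :
  integrableK mu f -> integrableK mu g ->
  integrableK mu (fun x => c * f x + g x) /\
  integralK mu (fun x => c * f x + g x) = c * integralK mu f + integralK mu g.
Proof.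
move=> [rf jf] [rg jg].
have [rcf rcfE] := Rintegral_lin (re c) (- im c) rf jf.
have [jcf jcfE] := Rintegral_lin (re c) (im c) jf rf.
have [rh rhE] := Rintegral_lin 1 1 rcf rg.
have [jh jhE] := Rintegral_lin 1 1 jcf jg.
have reE x : re (c * f x + g x)
    = 1 * (re c * re (f x) + - im c * im (f x)) + 1 * re (g x).
  by rewrite (reD axS) (reM axS) !mul1r mulNr.
have imE x : im (c * f x + g x)
    = 1 * (re c * im (f x) + im c * re (f x)) + 1 * im (g x).
  by rewrite (imD axS) (imM axS) !mul1r.
split.
  by split; [under eq_fun do rewrite reE | under eq_fun do rewrite imE].
rewrite /integralK -(mkM axS) -(mkD axS).
congr (mk S _ _).
  by under eq_Rintegral do rewrite reE; rewrite rhE rcfE !mul1r mulNr.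
by under eq_Rintegral do rewrite imE; rewrite jhE jcfE !mul1r.
Qed.

Hypothesis mu_fin : finite_moments mu.

Lemma integrable_ev (p : L) : integrableK mu (fun x => ev x p).
Proof.
apply: (monomials_ind axS (P := fun p => integrableK mu (fun x => ev x p))).
  by split; under eq_fun do rewrite raddf0 ?re0 ?im0; exact: integrable0.
move=> c m q mS qi.
have [+ _] := integralK_lin c (mu_fin mS) qi.
by rewrite /integrableK; under eq_fun do rewrite -linearP;
   under [in X in _ /\ X]eq_fun do rewrite -linearP.
Qed.

Lemma moment_linear : scalar (moment mu : L -> K).
Proof.
move=> c p q; rewrite /moment.
have [_ <-] := integralK_lin c (integrable_ev p) (integrable_ev q).
by congr integralK; apply/funext => x; rewrite linearP.
Qed.

Lemma mform_linear q : scalar (mform mu q : L -> K).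
Proof.
by move=> c p p'; rewrite /mform mulrDr -scalerAr moment_linear.
Qed.

Lemma re_ev_form x (q p : L) :
  re (ev x (invol q * p))
    = re (ev x q) * re (ev x p) + im (ev x q) * im (ev x p).
Proof.
by rewrite (evM axS) (ev_invol axS) (reM axS) (re_conj axS) (im_conj axS)
  mulNr opprK.
Qed.

Lemma im_ev_form x (q p : L) :
  im (ev x (invol q * p))
    = re (ev x q) * im (ev x p) - im (ev x q) * re (ev x p).
Proof.
by rewrite (evM axS) (ev_invol axS) (imM axS) (re_conj axS) (im_conj axS)
  mulNr.
Qed.

Lemma mform_herm (q p : L) : mform mu q p = conjK S (mform mu p q).
Proof.
rewrite /mform /moment /integralK (conj_mk axS); congr (mk S _ _).
  by apply: eq_Rintegral => x _; rewrite !re_ev_form mulrC [X in _ + X]mulrC.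
have [_ imi] := integrable_ev (invol p * q).
rewrite -mulN1r -RintegralZl //; apply: eq_Rintegral => x _.
by rewrite !im_ev_form mulN1r opprB mulrC [X in _ - X]mulrC.
Qed.

Local Notation a := (vanishing (supp mu)).

Lemma nonzero_measurable (p : L) :
  measurable ([set x | ev x p != 0] : set (borel (Omega S))).
Proof. by apply: sub_sigma_algebra; exact: open_nonzero. Qed.

(** Every point where [p] is nonzero lies outside the support, hence in a null
    open set, and [null_open] applies. *)
Lemma nonzero_null (p : L) : p \in a -> mu [set x | ev x p != 0] = 0%E.
Proof.
move=> /asboolP pa; apply: null_open; first exact: Omega_second_countable.
  exact: open_nonzero.
move=> x /= px; have : ~ supp mu x by move=> /pa /eqP; rewrite (negPf px).
move=> /existsNP [U] /not_implyP [oU] /not_implyP [Ux nU].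
exists U; split=> //; apply/eqP/negPn/negP => U0; apply: nU.
by exists setT; rewrite ?setTI.
Qed.

(** A point of the support where [p] is nonzero would have the null open
    neighborhood [p != 0]. *)
Lemma null_nonzero (p : L) : mu [set x | ev x p != 0] = 0%E -> p \in a.
Proof.
move=> p0; apply/asboolP => x suppx; apply/eqP/negPn/negP => px.
have oU := open_nonzero axS p.
have [A mA /eqP] := suppx [set x | ev x p != 0] oU px; apply.
have mU := nonzero_measurable p.
apply: (@subset_measure0 _ _ _ mu _ [set x | ev x p != 0]) => //.
exact: measurableI.
Qed.

(** The integrand vanishes off the null set [p != 0]. *)
Lemma mform_null (q p : L) : p \in a -> mform mu q p = 0.
Proof.
move=> /nonzero_null p0.
have mU := nonzero_measurable p.
have Rint0 (f : borel (Omega S) -> R) : mu.-integrable setT (EFin \o f) ->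
    (forall x, ev x p = 0 -> f x = 0) -> \int[mu]_x f x = 0.
  move=> fi f0; rewrite /Rintegral (negligible_integral mU _ fi) //.
  rewrite integral0_eq // => x [_ /negP]; rewrite negbK => /eqP /f0 /= ->.
  by [].
have [ri ii] := integrable_ev (invol q * p).
rewrite /mform /moment /integralK !Rint0 ?mk0 //.
  by move=> x px; rewrite im_ev_form px re0 im0 !mulr0 subr0.
by move=> x px; rewrite re_ev_form px re0 im0 !mulr0 addr0.
Qed.

(** The form at [(p, p)] is the integral of the squared modulus of [p]; were it
    zero, [p] would vanish almost everywhere. *)
Lemma mform_pos (p : L) : p \notin a -> 0 < mform mu p p.
Proof.
move=> pa; pose g x := re (ev x (invol p * p)).
have gE x : g x = re (ev x p) ^+ 2 + im (ev x p) ^+ 2 by rewrite /g re_ev_form.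
have g0 x : 0 <= g x by rewrite gE addr_ge0 ?sqr_ge0.
have [gi _] := integrable_ev (invol p * p).
have -> : mform mu p p = mk S (\int[mu]_x g x) 0.
  rewrite /mform /moment /integralK; congr (mk S _ _).
  rewrite /Rintegral integral0_eq // => x _.
  by rewrite im_ev_form mulrC subrr.
apply: mk_gt0 => //; rewrite lt_def Rintegral_ge0 // andbT.
apply: contra pa => /eqP gint; apply: null_nonzero.
(* A real-valued integral can also be zero because the extended one is
   infinite; integrability of [g] excludes this. *)
have : (\int[mu]_x `|(g x)%:E| = 0)%E.
  under eq_integral do rewrite gee0_abs ?lee_fin //.
  by rewrite -(fineK (integrable_fin_num measurableT gi)) -/(Rintegral _ _ _)
    gint.
move=> /(ae_eq_integral_abs mu measurableT (measurable_int mu gi)).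
have mU := nonzero_measurable p.
move=> gN; apply/negligibleP => //; apply: negligibleS gN => x /= px gx.
move/eqP: px; apply; have : g x = 0 by case: (gx I).
move/eqP; rewrite gE paddr_eq0 ?sqr_ge0 // !sqrf_eq0.
by move=> /andP[/eqP r0 /eqP i0]; exact: (re_im_eq0 axS).
Qed.
End Moments.

(** * The affine and the trigonometric case *)

Section Continuity.
Variables (K : numFieldType) (T : topologicalType).

Lemma continuous_exprn (f : T -> K) k :
  continuous f -> continuous (fun x => f x ^+ k).
Proof.
move=> cf; elim: k => [|k IH].
  by under eq_fun do rewrite expr0; exact: cst_continuous.
by under eq_fun do rewrite exprS; move=> x; apply: (continuousM (cf x) (IH x)).
Qed.

Lemma continuous_exprz (f : T -> K) (k : int) : (forall x, f x != 0) ->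
  continuous f -> continuous (fun x => f x ^ k).
Proof.
move=> f0 cf; case: k => k; first exact: continuous_exprn.
have cfk := @continuous_exprn f k.+1 cf.
by move=> x; apply: (continuousV _ (cfk x)); rewrite expf_neq0.
Qed.

Lemma open_neq0 (f : T -> K) : continuous f -> open [set x | f x != 0].
Proof.
move=> cf; apply: (@open_comp _ _ f [set y | y != 0]) => [x _|].
  exact: cf.
rewrite (_ : [set y | _] = ~` [set 0]).
  exact/closed_openC/accessible_closed_set1/hausdorff_accessible/norm_hausdorff.
by apply/seteqP; split=> y /= /eqP.
Qed.
End Continuity.

Lemma affine_moment_axioms (R : realType) (n : nat) :
  moment_axioms (affine R n).
Proof.
split=> //=; rewrite /re /im.
- by move=> _ _; rewrite addr0.
- by move=> x y; rewrite mul0r subr0.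
- by move=> x y; rewrite mulr0 mul0r addr0.
- by move=> c a b; rewrite mul0r subr0.
- by move=> _; rewrite oppr0.
- by move=> x p q; exact: mevalM.
- move=> P P0 PS p; elim/mpolyind: p => // c m p _ _; apply: PS.
  by exists m.
- move=> p; apply: open_neq0.
  under eq_fun do rewrite mevalE.
  apply: continuous_big; first exact: add_continuous.
  move=> m _ x; apply: continuousM; first exact: cst_continuous.
  apply: continuous_big; first exact: mul_continuous.
  by move=> i _; apply: continuous_exprn; exact: coord_continuous.
- exact/second_countable_mx/second_countable_real.
Qed.

Section LaurentEvalTheory.
Variables (n : nat) (F : fieldType) (z : 'rV[F]_n).
Local Notation L := (laurent n F).

Definition monomial_value (a : 'rV[int]_n) : F := \prod_(i < n) z 0 i ^ a 0 i.

Lemma leval_lmonom a c : leval z (lmonom a c) = c * monomial_value a.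
Proof.
(* The support of [lmonom a c] is empty, rather than [[fset a]], if [c = 0]. *)
rewrite /leval (big_fset_incl _ msuppU_le) /=; last first.
  by move=> b _ /mcoeff_outdom ->; rewrite mul0r.
by rewrite big_seq_fset1 mcoeffUU.
Qed.

Hypothesis z_neq0 : forall i, z 0 i != 0.

Lemma monomial_valueD a b :
  monomial_value (a + b) = monomial_value a * monomial_value b.
Proof.
by rewrite -big_split /=; apply: eq_bigr => i _; rewrite mxE expfzDr.
Qed.

Lemma levalM (p q : L) : leval z (p * q) = leval z p * leval z q.
Proof.
rewrite [p * q]/(lmul p q) /lmul raddf_sum mulr_suml; apply: eq_bigr => a _.
rewrite raddf_sum mulr_sumr; apply: eq_bigr => b _.
by rewrite /= leval_lmonom monomial_valueD mulrACA.
Qed.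
End LaurentEvalTheory.

Section TorusEval.
Variables (R : realType) (n : nat).
Implicit Types z : torus R n.

Lemma torus_norm z i : `|val z 0 i| = 1 :> R[i].
Proof. by have /set_mem := valP z; exact. Qed.

Lemma torus_neq0 z i : val z 0 i != 0 :> R[i].
Proof. by rewrite -normr_eq0 torus_norm oner_eq0. Qed.

Lemma torus_conj z i : conjc (val z 0 i : R[i]) = (val z 0 i)^-1.
Proof.
apply: (mulfI (torus_neq0 z i)); rewrite -sqr_normc torus_norm expr1n.
by rewrite divff // torus_neq0.
Qed.

(** On the torus, conjugating a coordinate is inverting it, which is what
    negating the exponents does. *)
Lemma leval_linvol z (p : laurent n R[i]) :
  leval (val z) (linvol p) = conjc (leval (val z) p).
Proof.
rewrite /linvol raddf_sum /leval rmorph_sum /=; apply: eq_bigr => a _.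
rewrite leval_lmonom rmorphM rmorph_prod /=; congr (_ * _).
apply: eq_bigr => i _; rewrite mxE -exprz_inv -torus_conj.
by case: (a 0 i) => k; rewrite /= ?fmorphV rmorphXn.
Qed.

Lemma leval_continuous (p : laurent n R[i]) :
  continuous (fun z : torus R n => leval (val z) p : R[i]^o).
Proof.
apply: continuous_big; first exact: add_continuous.
move=> a _ x; apply: continuousM; first exact: cst_continuous.
apply: continuous_big; first exact: mul_continuous.
move=> i _; apply: continuous_exprz => [z|z]; first exact: torus_neq0.
have cval : continuous (val : torus R n -> 'rV[R[i]^o]_n).
  exact: initial_continuous.
exact: (continuous_comp (cval z) (@coord_continuous R[i] _ _ 0 i _)).
Qed.
End TorusEval.

Lemma trigonometric_moment_axioms (R : realType) (n : nat) :
  moment_axioms (trigonometric R n).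
Proof.
split=> //=; rewrite /re /im.
- by case=> a b [c d].
- by case=> a b [c d].
- by case=> a b [c d].
- by case=> a b [c d].
- by case=> a b /= -> ->.
- by case=> c d a b.
- by case.
- by case.
- by move=> a a0; rewrite ltcE /= eqxx.
- by move=> x p q; apply: levalM => i; exact: torus_neq0.
- by move=> x p; exact: leval_linvol.
- move=> P P0 PS p; rewrite [p]laurentE.
  elim: (finmap.enum_fset (msupp p)) => [|a s IH]; first by rewrite big_nil.
  rewrite big_cons -[_ a p]mulr1 -lscaleU; apply: PS => //.
  by exists a.
- by move=> p; apply: open_neq0; exact: leval_continuous.
- apply: second_countable_initial; apply: second_countable_mx.
  exact: second_countable_complex.
Qed.

(** * Hermitian forms that are positive off a subspace *)

Section SemidefiniteForm.
Variables (K : numFieldType) (theta : {rmorphism K -> K}) (V : lmodType K).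
Variables (N : submodClosed V) (f : V -> V -> K).
Hypothesis f_linear : forall q, scalar (f q).
Hypothesis f_herm : forall q p, f q p = theta (f p q).
Hypothesis f_pos : forall p, p \notin N -> 0 < f p p.
Hypothesis f_null : forall q p, p \in N -> f q p = 0.

Lemma form_null_iff p : (f p p == 0) = (p \in N).
Proof.
apply/idP/idP => [|/f_null -> //].
by apply: contraTT => /f_pos /lt0r_neq0.
Qed.

Let fD q p p' : f q (p + p') = f q p + f q p'.
Proof. by rewrite -[p]scale1r f_linear mul1r scale1r. Qed.
Let f0 q : f q 0 = 0.
Proof. by rewrite f_null ?rpred0. Qed.
Let fZ q c p : f q (c *: p) = c * f q p.
Proof. by rewrite -[c *: p]addr0 f_linear f0 addr0. Qed.

Local Notation lift x := (repr (x : Quotient.quot (zmod_pred N))).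

(** The arguments are exchanged, so that the form induced by one that is linear
    in its second argument is linear in its first. *)
Definition quotient_form (x y : quotient N) : K := f (lift y) (lift x).

(** Representatives differ by elements of [N], which are orthogonal to
    everything: on the right by assumption, on the left by symmetry. *)
Lemma quotient_formE p q : quotient_form (proj N p) (proj N q) = f q p.
Proof.
have liftE u : exists2 v, v \in N & lift (proj N u) = v + u.
  exists (lift (proj N u) - u); last by rewrite subrK.
  by apply/proj_eq; rewrite {1}/proj reprK.
rewrite /quotient_form.
have [u uN ->] := liftE q; have [v vN ->] := liftE p.
by rewrite fD (f_null _ vN) add0r f_herm fD (f_null _ uN) add0r -f_herm.
Qed.

Lemma quotient_form_linearl y : scalar (quotient_form^~ y).
Proof.
move=> c u v; have [p ->] := proj_surj u; have [p' ->] := proj_surj v.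
by have [q ->] := proj_surj y; rewrite -linearP /= !quotient_formE f_linear.
Qed.

Lemma quotient_form_herm x y : quotient_form x y = theta (quotient_form y x).
Proof.
have [p ->] := proj_surj x; have [q ->] := proj_surj y.
by rewrite !quotient_formE.
Qed.

Lemma quotient_form_linearr x :
  GRing.linear_for (theta \; *%R) (quotient_form x).
Proof.
move=> c u v /=; rewrite quotient_form_herm quotient_form_linearl.
by rewrite rmorphD rmorphM /= -!quotient_form_herm.
Qed.

Lemma quotient_form_pos x : x != 0 -> 0 < quotient_form x x.
Proof.
have [p ->] := proj_surj x; rewrite quotient_formE => px.
apply: f_pos; apply: contra_neqN px => pN.
by rewrite -(raddf0 (proj N)); apply/proj_eq; rewrite subr0.
Qed.

HB.instance Definition _ := @bilinear_isBilinear.Build K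
  (quotient N) (quotient N) K *%R (theta \; *%R) quotient_form
  (quotient_form_linearl, quotient_form_linearr).
HB.instance Definition _ := @isHermitianSesquilinear.Build K (quotient N)
  false theta quotient_form
  (fun x y => etrans (quotient_form_herm x y) (esym (mul1r _))).
HB.instance Definition _ := @isDotProduct.Build K (quotient N) quotient_form
  quotient_form_pos.

Definition quotient_dot : {dot quotient N for theta} := quotient_form.

Variables (d : nat) (B : 'I_d -> V).
Local Notation gram_matrix := (\matrix_(i, j) f (B i) (B j) : 'M[K]_d).

Lemma gram_mulE (c : 'cV[K]_d) i :
  (gram_matrix *m c) i 0 = f (B i) (\sum_j c j 0 *: B j).
Proof.
rewrite mxE (big_morph (f (B i)) (fD (B i)) (f0 (B i))).
by apply: eq_bigr => j _; rewrite fZ mxE mulrC.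
Qed.

(** A combination of the [B i] that is orthogonal to each of them is orthogonal
    to itself, hence in [N]. *)
Lemma gram_kerE (c : 'cV[K]_d) :
  gram_matrix *m c = 0 <-> \sum_j c j 0 *: B j \in N.
Proof.
split=> [Hc|cN]; last first.
  by apply/colP => i; rewrite gram_mulE mxE f_null.
rewrite -form_null_iff; set v := \sum_j _.
rewrite {2}/v (big_morph (f v) (fD _) (f0 _)) big1 // => i _.
by rewrite fZ f_herm -gram_mulE Hc mxE rmorph0 mulr0.
Qed.

Lemma gram_unitE :
  gram_matrix \in unitmx <-> lin_indep (fun i => proj N (B i)).
Proof.
set H := gram_matrix.
have E (c : 'cV[K]_d) : \sum_i c i 0 *: proj N (B i) = 0 <-> H *m c = 0.
  rewrite gram_kerE; set v := \sum_j _ *: B j.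
  rewrite -[X in X = 0](_ : proj N v = _); last first.
    by rewrite raddf_sum; apply: eq_bigr => i _ /=; rewrite linearZ_LR.
  by rewrite -{1}(raddf0 (proj N)) -{2}[v]subr0; exact: proj_eq.
split=> [Hu c c0 i|Hi].
  have : H *m (\col_i c i) = 0.
    by apply/E; rewrite -[RHS]c0; apply: eq_bigr => j _; rewrite mxE.
  move=> /(congr1 (mulmx (invmx H))); rewrite mulKmx // mulmx0 => /colP/(_ i).
  by rewrite !mxE.
(* [inj_row_free] speaks of row vectors, the relations are columns. *)
rewrite -unitmx_tr -row_free_unit; apply: inj_row_free => v Hv.
apply/rowP => i; rewrite mxE -[v]trmxK mxE.
apply: (Hi (fun i => v^T i 0)); apply/E.
by rewrite -[LHS]trmxK trmx_mul trmxK Hv trmx0.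
Qed.
End SemidefiniteForm.

(** * The induced form and the kernel of the Gram matrix *)

Theorem proposition4p10 (R : realType) (n : nat) (S : setting R)
    (HS : S = affine R n \/ S = trigonometric R n)
    (mu : {measure set (borel (Omega S)) -> \bar R})
    (Hmu : finite_moments mu)
    (W : submodClosed (lpoly S)) :
  let a : submodClosed (lpoly S) := vanishing (supp mu) in
  let aW : submodClosed (subspace_of W) := trace_in a W in
  (* [{dot _ for _}] is linear in its first and semilinear in its second
     argument, the opposite of [mform] *)
  (exists phi : {dot quotient aW for conjK S},
     forall q p : subspace_of W,
       phi (proj aW p) (proj aW q) = mform mu (val q) (val p)) /\
  (forall (d : nat) (B : 'I_d -> subspace_of W), is_basis B ->
     [set p : lpoly S | (p \in a) && (p \in W)] =
       [set \sum_i c i 0 *: val (B i) |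
          c in [set c : 'cV[base_field S]_d | gram mu B *m c = 0]] /\
     (gram mu B \in unitmx <-> lin_indep (fun i => proj aW (B i)))).
Proof.
move=> a aW.
have axS : moment_axioms S.
  case: HS => ->; first exact: affine_moment_axioms.
  exact: trigonometric_moment_axioms.
pose f (q p : subspace_of W) := mform mu (val q) (val p).
have flin q : scalar (f q).
  by move=> c p p'; rewrite /f linearP; exact: mform_linear.
have fherm q p : f q p = conjK S (f p q) by exact: mform_herm.
have fpos p : p \notin aW -> 0 < f p p by exact: mform_pos.
have fnull q p : p \in aW -> f q p = 0 by exact: mform_null.
split.
  exists (quotient_dot flin fherm fpos fnull) => q p.
  exact: (@quotient_formE _ _ _ _ _ flin fherm fnull).
move=> d B [_ spanB]; split; last exact: (gram_unitE flin fherm fpos fnull).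
have kerE := gram_kerE flin fherm fpos fnull B.
have valE (c : 'I_d -> base_field S) :
    val (\sum_i c i *: B i) = \sum_i c i *: val (B i).
  by rewrite raddf_sum.
apply/seteqP; split=> [p /= /andP[pa pW]|_ [c /kerE cN <-]].
  have [c cE] := spanB (Subspace_of pW).
  exists (\col_i c i) => /=.
    apply/kerE; under eq_bigr do rewrite mxE.
    by rewrite -cE.
  by under eq_bigr do rewrite mxE; rewrite -valE -cE.
by apply/andP; rewrite -valE; split; [exact: cN | exact: valP].
Qed.
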